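(* Let $N=p_1p_2\cdots p_m$ be a squarefree composite positive integer with primes $p_1<p_2<\dots<p_m$ ($m\ge 2$). For $k\in\mathbb{Z}\setminus\{-1\}$ and a prime $p\mid N$ put $M(k,p)=\frac{N+kp}{k+1}$. If $\alpha\in\mathbb{Q}\text{-}\mathcal{KS}(N)$, then $$M(-m-2,p_1)\le\alpha\le\min\big(M(m-1,p_{m-1}),\,M(m,p_m)\big).$$
   Context: For a positive integer $N\ge 2$, the $\mathbb{Q}$-Korselt set $\mathbb{Q}\text{-}\mathcal{KS}(N)$ is the set of all rationals $\alpha=\frac{\alpha_1}{\alpha_2}\in\mathbb{Q}\setminus\{0,N\}$ (written with $\alpha_1\in\mathbb{Z}$, $\alpha_2>0$, $\gcd(\alpha_1,\alpha_2)=1$) such that the integer $\alpha_2p-\alpha_1$ divides the integer $\alpha_2N-\alpha_1$ for every prime divisor $p$ of $N$. Its elements are called $N$-Korselt rational bases. *)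

(* Defs.v *)
From mathcomp Require Import all_boot all_order all_algebra.

Set Implicit Arguments.
Unset Strict Implicit.
Unset Printing Implicit Defensive.

Import Order.TTheory GRing.Theory Num.Theory.

Local Open Scope ring_scope.

(* [numq] and [denq] give the reduced fraction with positive denominator;
   [(0 %| x)%Z] holds only for [x = 0]. *)
Definition QKorselt (N : nat) (alpha : rat) : Prop :=
  [/\ alpha != 0,
      alpha != N%:Q &
      forall p : nat, prime p -> (p %| N)%N ->
        (denq alpha * p%:Z - numq alpha %| denq alpha * N%:Z - numq alpha)%Z].

(* Meaningful only for [k != -1]. *)
Definition M (N : nat) (k : int) (p : nat) : rat :=
  (N%:Q + k%:Q * p%:Q) / (k + 1)%:Q.

(* Main.v *)
Require Import Defs.
From mathcomp Require Import all_boot all_order all_algebra.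
From mathcomp Require Import zify ring.
Import Order.TTheory GRing.Theory Num.Theory.
Local Open Scope ring_scope.

(** Write [alpha = a / b] in lowest terms. As [b * p_i - a] is coprime to [b],
    it divides [N - p_i]; let [l_i] be the quotient up to sign. If [alpha > p_j],
    the positive integers [l_1, ..., l_j] increase strictly and [b * l_1 >= 2],
    whence [b * l_j >= j + 1]: these are the upper bounds. If [alpha < p_1],
    they decrease strictly and [b * l_1 >= m + 1], unless [b = 1], [l_{m-1} = 2]
    and [l_m = 1]; then [N = 4 p_m - 3 p_{m-1}], so [p_m] divides [3 p_{m-1}],
    which forces [p_m = 3], [p_{m-1} = 2], [N = 6] and the excluded value
    [alpha = 0]. *)

Lemma korselt_quotient {N q : nat} {alpha : rat} :
  QKorselt N alpha -> prime q -> (q %| N)%N ->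
  exists l : int, N%:Z - q%:Z = l * (denq alpha * q%:Z - numq alpha).
Proof.
move=> [_ _ korselt] q_pr qN; apply/dvdzP.
have cop : coprimez (denq alpha * q%:Z - numq alpha) (denq alpha).
  rewrite /coprimez gcdzC mulrC gcdzMDl -/(coprimez _ _) coprimezN coprimez_sym.
  exact: coprime_num_den.
rewrite -(Gauss_dvdzr _ cop).
have -> : denq alpha * (N%:Z - q%:Z) = (denq alpha * N%:Z - numq alpha)
   - (denq alpha * q%:Z - numq alpha) by ring.
by rewrite rpredB // korselt.
Qed.

Lemma numq_neq_denq_mul {N : nat} {alpha : rat} :
  alpha != N%:Q -> numq alpha != denq alpha * N%:Z.
Proof.
apply: contraNneq => eq_num.
by rewrite -[alpha]divq_num_den eq_num intrM mulrC mulKf // intr_eq0 denq_neq0.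
Qed.

(** Since [M N k q] is $q + (N-q)/(k+1)$, clearing denominators turns the bound into an integer
    inequality, ready for $N - q = l(a - bq)$. *)
Lemma le_M {N q : nat} {k : int} {alpha : rat} : 0 < k + 1 ->
  (k + 1) * (numq alpha - denq alpha * q%:Z) <= denq alpha * (N%:Z - q%:Z) ->
  alpha <= M N k q.
Proof.
move=> k_gt0 le_int; rewrite /M ler_pdivlMr ?ltr0z //.
rewrite -[alpha]divq_num_den mulrAC ler_pdivrMr ?ltr0z ?denq_gt0 //.
rewrite -!rmorphM -!rmorphD -!rmorphM ler_int; lia.
Qed.

Lemma M_le {N q : nat} {k : int} {alpha : rat} : k + 1 < 0 ->
  (k + 1) * (numq alpha - denq alpha * q%:Z) <= denq alpha * (N%:Z - q%:Z) ->
  M N k q <= alpha.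
Proof.
move=> k_lt0 le_int; rewrite /M ler_ndivrMr ?ltrz0 //.
rewrite -[alpha]divq_num_den mulrAC ler_pdivrMr ?ltr0z ?denq_gt0 //.
rewrite -!rmorphM -!rmorphD -!rmorphM ler_int; lia.
Qed.

(** Equality $bl = 1$ would force $b = l = 1$, hence $a = N$, which is excluded. *)
Lemma quotient_bound_below {a b N x l : int} : 0 < b -> x < N -> a != b * N -> b * x < a ->
  N - x = l * (a - b * x) -> 1 < b * l.
Proof.
move=> b_gt0 xN aN xa def_l.
have l_gt0 : 0 < l by rewrite -(pmulr_lgt0 l (x := a - b * x)) ?subr_gt0 // -def_l subr_gt0.
have : 0 < b * l by rewrite mulr_gt0.
rewrite lt_def; nia.
Qed.

Lemma quotient_incr {a b N x y lx ly : int} :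
  0 < b -> x < y -> b * y < a -> 1 < b * lx ->
  N - x = lx * (a - b * x) -> N - y = ly * (a - b * y) -> lx < ly.
Proof.
move=> b_gt0 xy ya blx def_x def_y.
(* Subtract the two equations after writing $a - bx = (a - by) + b(y - x)$; the sign of [ly - lx]
   can then be read off. *)
have eq : (ly - lx) * (a - b * y) = (y - x) * (b * lx - 1).
  by rewrite mulrBl -def_y; move: def_x; lia.
by rewrite -subr_gt0 -(pmulr_lgt0 _ (x := a - b * y)) ?subr_gt0 // eq mulr_gt0 ?subr_gt0.
Qed.

Lemma quotient_decr {a b N x y lx ly : int} :
  0 < b -> x < y -> a < b * x -> 0 < ly ->
  N - x = lx * (b * x - a) -> N - y = ly * (b * y - a) -> ly < lx.
Proof.
move=> b_gt0 xy ax ly_gt0 def_x def_y.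
have eq : (lx - ly) * (b * x - a) = (y - x) * (1 + b * ly).
  by rewrite mulrBl -def_x; move: def_y; lia.
rewrite -subr_gt0 -(pmulr_lgt0 _ (x := b * x - a)) ?subr_gt0 // eq.
by rewrite mulr_gt0 ?subr_gt0 // addr_gt0 // mulr_gt0.
Qed.

(** Here $r \mid 3q$ and $r \nmid q$, so $r = 3$, $q = 2$ and $N = 6$. The conclusion is stated as
    $2r = N$ because the exceptional case has $a = 2r - N$. *)
Lemma prime_pair_exception {q r N : nat} : prime q -> prime r -> (q < r)%N ->
  (r %| N)%N -> N%:Z = 4 * r%:Z - 3 * q%:Z -> 2 * r%:Z = N%:Z.
Proof.
move=> q_pr r_pr qr rN defN.
have defN' : (N + 3 * q = 4 * r)%N by lia.
have : (r %| 3 * q)%N by rewrite -(dvdn_addr _ rN) defN' dvdn_mull.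
rewrite Euclid_dvdM // => /orP[|/dvdn_leq]; last first.
  by move/(_ (prime_gt0 q_pr)); lia.
rewrite dvdn_prime2 // => /eqP r3.
have := prime_gt1 q_pr; lia.
Qed.

Theorem theorem2p5 (N m : nat) (p : nat -> nat) (alpha : rat)
    (hm : (2 <= m)%N)
    (p_prime : forall i : nat, (1 <= i <= m)%N -> prime (p i))
    (p_incr : forall i j : nat, (1 <= i)%N -> (i < j)%N -> (j <= m)%N -> (p i < p j)%N)
    (hN : N = (\prod_(1 <= i < m.+1) p i)%N)
    (halpha : QKorselt N alpha) :
  M N (- m%:Z - 2) (p 1%N) <= alpha
  /\ alpha <= Num.min (M N (m%:Z - 1) (p (m - 1)%N)) (M N m%:Z (p m)).
Proof.
have p_dvd i : (1 <= i <= m)%N -> (p i %| N)%N.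
  move=> i_range; rewrite hN (bigD1_seq i) ?iota_uniq ?mem_index_iota //=.
  exact: dvdn_mulr.
have N_gt0 : (0 < N)%N.
  by rewrite hN big_nat_cond prodn_cond_gt0 // => i; rewrite andbT => /p_prime/prime_gt0.
have p_lt i : (1 <= i <= m)%N -> (p i)%:Z < N%:Z.
  move=> i_range; rewrite ltz_nat ltn_neqAle dvdn_leq ?p_dvd // andbT.
  apply/eqP => piN.
  (* As $m \ge 2$, a second prime factor exists; it would divide $p_i = N$ and so equal $p_i$. *)
  have [j j_range ji] : exists2 j, (1 <= j <= m)%N & j != i.
    by case: (eqVneq i 1%N) => [->|i1]; [exists 2%N | exists 1%N]; lia.
  have := p_dvd _ j_range.
  rewrite -piN dvdn_prime2 ?p_prime // => /eqP pji.
  by case: (ltngtP i j) ji => // ij _; [have := p_incr i j | have := p_incr j i]; lia.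
have [alpha_neq0 alpha_neqN _] := halpha.
have numN := numq_neq_denq_mul alpha_neqN.
have quo i (hi : (1 <= i <= m)%N) := korselt_quotient halpha (p_prime i hi) (p_dvd i hi).
have num_neq0 : numq alpha != 0 by rewrite numq_eq0.
have b_gt0 := denq_gt0 alpha.
set a := numq alpha in numN quo num_neq0 *; set b := denq alpha in numN quo b_gt0 *.
have upper j : (1 <= j <= m)%N -> b * (p j)%:Z < a ->
    exists2 l : int, N%:Z - (p j)%:Z = l * (a - b * (p j)%:Z) & j%:Z + 1 <= b * l.
  elim: j => // j IHj hj pa.
  have [l] := quo _ hj; rewrite -mulrNN opprB => def_l.
  exists (- l) => //.
  have := quotient_bound_below b_gt0 (p_lt _ hj) numN pa def_l.
  case: (posnP j) => [-> | j_gt0]; first lia.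
  have hj' : (1 <= j <= m)%N by lia.
  have pj : (p j)%:Z < (p j.+1)%:Z by rewrite ltz_nat p_incr; lia.
  have pja : b * (p j)%:Z < a by rewrite (lt_trans _ pa) // ltr_pM2l.
  have [l' def_l' le_l'] := IHj hj' pja.
  (* Each step raises the quotient by at least 1, hence $b$ times it by at least $b \ge 1$. *)
  have := quotient_incr b_gt0 pj pa _ def_l' def_l.
  move=> /(_ ltac:(lia)) ll' _; nia.
(* The quotients grow as the primes shrink, so the induction descends from $p_m$. At [k = 0] only
   positivity is available; the bound starts at [k = 1]. *)
have lower : a < b * (p 1%N)%:Z -> forall k, (k < m)%N ->
    exists l : int, [/\ N%:Z - (p (m - k)%N)%:Z = l * (b * (p (m - k)%N)%:Z - a),
      0 < l & (0 < k)%N -> k%:Z + 2 <= b * l].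
  move=> ap; have ap' i : (1 <= i <= m)%N -> a < b * (p i)%:Z.
    move=> hi; apply: (lt_le_trans ap); rewrite ler_pM2l // lez_nat.
    by case: (ltngtP 1%N i) hi => [i1 hi|//|<- //]; rewrite ltnW // p_incr; lia.
  elim=> [_|k IHk km].
    have hi : (1 <= m - 0 <= m)%N by lia.
    have [l def_l] := quo _ hi; exists l; split=> //.
    by rewrite -(pmulr_lgt0 l (x := b * (p (m - 0)%N)%:Z - a)) ?subr_gt0 ?ap' // -def_l subr_gt0 p_lt.
  have [l' [def_l' l'_gt0 le_l']] := IHk (ltnW km).
  have hi : (1 <= m - k.+1 <= m)%N by lia.
  have hi' : (1 <= m - k <= m)%N by lia.
  have [l def_l] := quo _ hi; exists l.
  have pp : (p (m - k.+1)%N < p (m - k)%N)%N by rewrite p_incr; lia.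
  have ppZ : (p (m - k.+1)%N)%:Z < (p (m - k)%N)%:Z by rewrite ltz_nat.
  have ll' := quotient_decr b_gt0 ppZ (ap' _ hi) l'_gt0 def_l def_l'.
  split=> //; first lia.
  move=> _; case: (posnP k) => [k0|k_gt0]; last by have := le_l' k_gt0; nia.
  (* Here $l > l' \ge 1$, so $bl < 3$ leaves only $b = 1$, $l = 2$, $l' = 1$. *)
  case: (lerP 3 (b * l)) => [|bl]; first by lia.
  have b1 : b = 1 by nia.
  have l2 : l = 2 by nia.
  have l'1 : l' = 1 by lia.
  move: def_l def_l'; rewrite l2 l'1 b1 => def_l def_l'.
  have := prime_pair_exception (p_prime _ hi) (p_prime _ hi') pp (p_dvd _ hi').
  move=> /(_ ltac:(lia)) eqN.
  by case/eqP: num_neq0; lia.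
have upper_le j : (1 <= j <= m)%N ->
    (j%:Z + 1) * (a - b * (p j)%:Z) <= b * (N%:Z - (p j)%:Z).
  move=> hj; case: (ltrP (b * (p j)%:Z) a) => [pa|ap].
    have [l -> le_l] := upper _ hj pa.
    by rewrite mulrA ler_wpM2r // subr_ge0 ltW.
  apply: (@le_trans _ _ 0); first by rewrite mulr_ge0_le0 ?subr_le0.
  by rewrite mulr_ge0 ?subr_ge0 ?(ltW b_gt0) ?(ltW (p_lt _ _)).
split.
  apply: M_le; first lia.
  rewrite -/a -/b.
  have hi : (1 <= 1 <= m)%N by lia.
  case: (ltrP a (b * (p 1%N)%:Z)) => [ap|pa].
    have [l []] := lower ap (m.-1) ltac:(lia).
    have -> : (m - m.-1 = 1)%N by lia.
    move=> -> _ /(_ ltac:(lia)) le_l.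
    (* With $k = -m-2$ the factor $k + 1$ is $-(m+1)$, so what remains is $m + 1 \le bl$. *)
    rewrite mulrA -mulrNN opprB ler_wpM2r ?subr_ge0 ?(ltW ap) //; lia.
  apply: (@le_trans _ _ 0); first by rewrite mulr_le0_ge0 ?subr_ge0 //; lia.
  by rewrite mulr_ge0 ?subr_ge0 ?(ltW b_gt0) ?(ltW (p_lt _ _)).
rewrite le_min; apply/andP; split; apply: le_M; rewrite -/a -/b; try lia.
  have -> : m%:Z - 1 + 1 = (m - 1)%N%:Z + 1 by lia.
  by apply: upper_le; lia.
by apply: upper_le; lia.
Qed.
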